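(* Let $n$ be a positive integer, let $G_1$ and $G_2$ be two finite groups, let $H_1$ be a subgroup of $G_1$ and let $H_2$ be a subgroup of $G_2$. If $(H_1,G_1)$ and $(H_2,G_2)$ are relative $n$-isoclinic, then $d^{(n)}(H_1,G_1)=d^{(n)}(H_2,G_2)$.
   Context: $Z_n(G)$ denotes the $n$-th term of the upper central series of $G$. Commutators are left-normed: $[x_1,x_2]=x_1^{-1}x_2^{-1}x_1x_2$ and $[x_1,\dots,x_{k+1}]=[[x_1,\dots,x_k],x_{k+1}]$. For a subgroup $H$ of $G$, $[_nH,G]$ denotes $[H,\dots,H,G]$ ($n$ copies of $H$), i.e. the subgroup of $G$ generated by all $[h_1,\dots,h_n,g]$ with $h_1,\dots,h_n\in H$, $g\in G$. For a subgroup $H$ of a finite group $G$, the relative $n$-th nilpotency degree of $H$ in $G$ is $$d^{(n)}(H,G)=\frac{|\{(x_1,\dots,x_n,g)\in H^n\times G : [x_1,\dots,x_n,g]=1\}|}{|H|^n|G|}.$$ Definition (relative $n$-isoclinism). Let $H_i$ be a subgroup of a group $G_i$, $i=1,2$. The pairs $(H_1,G_1)$ and $(H_2,G_2)$ are relative $n$-isoclinic if there is a pair $(\alpha,\beta)$ such that: (i) $\alpha:G_1/Z_n(G_1)\to G_2/Z_n(G_2)$ is an isomorphism whose restriction to $H_1/(Z_n(G_1)\cap H_1)$ is an isomorphism onto $H_2/(Z_n(G_2)\cap H_2)$, where $H_i/(Z_n(G_i)\cap H_i)$ is identified with the image $H_iZ_n(G_i)/Z_n(G_i)$ of $H_i$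 in $G_i/Z_n(G_i)$; (ii) $\beta:[_nH_1,G_1]\to[_nH_2,G_2]$ is an isomorphism; (iii) for all $h_1,\dots,h_n\in H_1$, $g_1\in G_1$, $k_1,\dots,k_n\in H_2$, $g_2\in G_2$ with $\alpha(h_i(Z_n(G_1)\cap H_1))=k_i(Z_n(G_2)\cap H_2)$ for $1\le i\le n$ and $\alpha(g_1Z_n(G_1))=g_2Z_n(G_2)$, one has $\beta([h_1,\dots,h_n,g_1])=[k_1,\dots,k_n,g_2]$. *)

(* Defs.v *)
From mathcomp Require Import all_boot all_order all_algebra all_fingroup.
From mathcomp Require Import all_solvable.

Set Implicit Arguments.
Unset Strict Implicit.
Unset Printing Implicit Defensive.

Import GroupScope.

(* The value on [::] is junk. *)
Definition lncomm (gT : finGroupType) (s : seq gT) : gT :=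
  if s is x :: s' then foldl commg x s' else 1.

Definition powprod (gT : finGroupType) (n : nat) (H G : {set gT}) :
    {set n.-tuple gT * gT} :=
  [set u | [forall i, tnth u.1 i \in H] & u.2 \in G].

Definition lncomm_subgroup (gT : finGroupType) (n : nat) (H G : {set gT}) :
    {set gT} :=
  <<[set lncomm (rcons u.1 u.2) | u : n.-tuple gT * gT in powprod n H G]>>.

Canonical lncomm_subgroup_group (gT : finGroupType) (n : nat)
    (H G : {set gT}) : {group gT} :=
  Eval hnf in [group of lncomm_subgroup n H G].

Definition rel_nil_degree (gT : finGroupType) (n : nat) (H G : {set gT}) :
    rat :=
  (#|[set u : n.-tuple gT * gT in powprod n H G
        | lncomm (rcons u.1 u.2) == 1%g]|%:R
     / (#|H| ^ n * #|G|)%N%:R)%R.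

(* [isom A B f] is defined for any function f, so that [isom] applied to the
   images H / 'Z_n(G) says that alpha restricts to an isomorphism between them. *)
Definition rel_isoclinic (gT1 gT2 : finGroupType) (n : nat)
    (H1 G1 : {group gT1}) (H2 G2 : {group gT2}) : Prop :=
  exists (alpha : {morphism G1 / 'Z_n(G1) >-> coset_of 'Z_n(G2)})
         (beta : {morphism lncomm_subgroup n H1 G1 >-> gT2}),
  [/\ isom (G1 / 'Z_n(G1)) (G2 / 'Z_n(G2)) alpha
        /\ isom (H1 / 'Z_n(G1)) (H2 / 'Z_n(G2)) alpha,
      isom (lncomm_subgroup n H1 G1) (lncomm_subgroup n H2 G2) beta
    & forall (h : n.-tuple gT1) (g1 : gT1) (k : n.-tuple gT2) (g2 : gT2),
        (forall i, tnth h i \in H1) -> g1 \in G1 ->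
        (forall i, tnth k i \in H2) -> g2 \in G2 ->
        (forall i, alpha (coset 'Z_n(G1) (tnth h i))
                     = coset 'Z_n(G2) (tnth k i)) ->
        alpha (coset 'Z_n(G1) g1) = coset 'Z_n(G2) g2 ->
        beta (lncomm (rcons h g1)) = lncomm (rcons k g2)].

(* Main.v *)
Require Import Defs.
From mathcomp Require Import all_boot all_order all_algebra all_fingroup.
From mathcomp Require Import all_solvable.

(** Why the theorem is true.  Let Q be the quotient of G2 by its n-th upper
    centre.  Both pairs map to Q: the pair (H2, G2) by the canonical
    projection, the pair (H1, G1) by the canonical projection followed by
    alpha, and these two maps have the same images of H1 and H2, and of G1 and
    G2.  Applied coordinatewise, they send H1^n x G1 and H2^n x G2 onto one
    and the same set W of tuples over Q ([powprod_image_morphim]).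

    If two tuples, one on each side, have the same image in W, then beta sends
    the commutator of the first to the commutator of the second; as beta is
    injective, one commutator is trivial exactly when the other is.  Hence the
    solutions of [x_1, ..., x_n, g] = 1 on either side form a union of fibres
    over W, and they lie above the same subset T of W on both sides.

    Each side being a power of a group homomorphism, all its fibres have the
    same cardinality ([card_powprod_fibre]), so each degree is the proportion
    #|T| / #|W| ([rel_nil_degree_image]), the same for both sides
    ([rel_nil_degree_transfer]).

    That the commutator depends only on the classes of its entries modulo the
    n-th upper centre is here a consequence of the compatibility of alpha and
    beta: two tuples with the same image are compared through a common partner
    on the other side. *)

Set Implicit Arguments.
Unset Strict Implicit.
Unset Printing Implicit Defensive.

Import GroupScope.

Definition solutions (gT : finGroupType) (n : nat) (H G : {set gT}) :
    {set n.-tuple gT * gT} :=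
  [set u in powprod n H G | lncomm (rcons u.1 u.2) == 1].

Definition map_entries (aT rT : Type) (n : nat) (f : aT -> rT)
    (u : n.-tuple aT * aT) : n.-tuple rT * rT :=
  (map_tuple f u.1, f u.2).

Lemma powprodP (gT : finGroupType) n (H G : {set gT}) (u : n.-tuple gT * gT) :
  reflect ((forall i, tnth u.1 i \in H) /\ u.2 \in G) (u \in powprod n H G).
Proof.
rewrite inE; apply: (iffP andP) => -[uH uG]; split=> //; exact/forallP.
Qed.

Lemma map_entriesP (aT rT sT : Type) n (f : aT -> sT) (g : rT -> sT)
    (u : n.-tuple aT * aT) (v : n.-tuple rT * rT) :
  map_entries f u = map_entries g v <->
  (forall i, f (tnth u.1 i) = g (tnth v.1 i)) /\ f u.2 = g v.2.
Proof.
split=> [uv | [uv1 uv2]].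
  have [/= uv1 uv2] := (congr1 fst uv, congr1 snd uv).
  split=> // i; have := congr1 (fun t => tnth t i) uv1.
  by rewrite !tnth_map.
by congr pair => //; apply: eq_from_tnth => i; rewrite !tnth_map.
Qed.

Lemma card_powprod (gT : finGroupType) n (H G : {set gT}) :
  #|powprod n H G| = (#|H| ^ n * #|G|)%N.
Proof.
have -> : powprod n H G
    = setX [set t : n.-tuple gT | [forall i, tnth t i \in H]] G.
  by apply/setP=> -[t g]; rewrite !inE.
rewrite cardsX; congr (_ * _)%N.
rewrite -[X in (_ ^ X)%N]card_ord -card_ffun_on.
rewrite -(card_imset _ (can_inj (@finfun_of_tupleK gT n))).
apply: eq_card => f; apply/imsetP/ffun_onP => [[t + ->] i | fH].
  by rewrite inE => /forallP/(_ i); rewrite ffunE.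
exists (tuple_of_finfun f); last by rewrite tuple_of_finfunK.
by rewrite inE; apply/forallP=> i; rewrite tnth_mktuple.
Qed.

Lemma powprod_image_morphim (aT rT : finGroupType) (D : {group aT})
    (f : {morphism D >-> rT}) n (H G : {set aT}) :
    H \subset D -> G \subset D ->
  map_entries f @: powprod n H G = powprod n (f @* H) (f @* G).
Proof.
move=> sHD sGD; apply/setP=> w; apply/imsetP/powprodP.
  case=> u /powprodP[uH uG] ->; split=> [i|] /=; last first.
    by rewrite mem_morphim ?(subsetP sGD).
  by rewrite tnth_map mem_morphim ?(subsetP sHD).
case=> [wH /morphimP[g _ gG wg]].
have /fin_all_exists2[h hH wh] : forall i,
    exists2 x, x \in H & f x = tnth w.1 i.
  by move=> i; case/morphimP: (wH i) => x _ xH ->; exists x.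
exists ([tuple h i | i < n], g).
  by apply/powprodP; split=> [i|] //=; rewrite tnth_mktuple.
case: w wH wg wh => t y /= _ -> wh; congr pair.
by apply: eq_from_tnth => i; rewrite tnth_map tnth_mktuple.
Qed.

(** Translation by a point of the fibre identifies the fibre with the tuples
    whose entries lie in the kernel. *)
Lemma card_powprod_fibre (aT rT : finGroupType) (D : {group aT})
    (f : {morphism D >-> rT}) n (H G : {group aT}) (u : n.-tuple aT * aT) :
    H \subset D -> G \subset D -> u \in powprod n H G ->
  #|[set v in powprod n H G | map_entries f v == map_entries f u]|
    = (#|'ker_H f| ^ n * #|'ker_G f|)%N.
Proof.
move=> sHD sGD /powprodP[uH uG]; rewrite -card_powprod.
pose shift (v : n.-tuple aT * aT) :=
  ([tuple (tnth u.1 i)^-1 * tnth v.1 i | i < n], u.2^-1 * v.2).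
have shift_inj : injective shift.
  move=> [v g] [w h] vw; have [/= vw1 vw2] := (congr1 fst vw, congr1 snd vw).
  congr pair; last exact: mulgI vw2.
  apply: eq_from_tnth => i; apply: (mulgI (tnth u.1 i)^-1).
  by have := congr1 (fun t => tnth t i) vw1; rewrite !tnth_mktuple.
have ker_shift (K : {group aT}) x y : K \subset D -> x \in K ->
    (x^-1 * y \in 'ker_K f) = (y \in K) && (f y == f x).
  move=> sKD xK; rewrite inE groupMl ?groupV //.
  have [yK /= | //] := boolP (y \in K).
  have [xD yD] := (subsetP sKD x xK, subsetP sKD y yK).
  rewrite !inE groupM ?groupV //= morphM ?groupV // morphV //.
  by rewrite -eq_mulVg1 eq_sym.
rewrite -(card_preimset (powprod n _ _) shift_inj); congr #|pred_of_set _|.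
apply/setP=> v; rewrite [RHS]in_set; apply/setIdP/powprodP.
  case=> /powprodP[vH vG] /eqP/map_entriesP[vu1 vu2].
  split=> [i|] /=; last by rewrite ker_shift // vG vu2 eqxx.
  by rewrite tnth_mktuple ker_shift // vH vu1 eqxx.
case=> /= vu1; rewrite ker_shift // => /andP[vG /eqP vu2].
have {}vu1 i : (tnth v.1 i \in H) && (f (tnth v.1 i) == f (tnth u.1 i)).
  by rewrite -ker_shift //; have := vu1 i; rewrite tnth_mktuple.
split; first by apply/powprodP; split=> // i; case/andP: (vu1 i).
by apply/eqP/map_entriesP; split=> // i; case/andP: (vu1 i) => _ /eqP.
Qed.

Lemma card_saturated (aT rT : finGroupType) (D : {group aT})
    (f : {morphism D >-> rT}) n (H G : {group aT})
    (S : {set n.-tuple aT * aT}) :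
    H \subset D -> G \subset D -> S \subset powprod n H G ->
    (forall u v, u \in S -> v \in powprod n H G ->
       map_entries f v = map_entries f u -> v \in S) ->
  #|S| = (#|map_entries f @: S| * (#|'ker_H f| ^ n * #|'ker_G f|))%N.
Proof.
move=> sHD sGD /subsetP sSP satS.
rewrite -sum1_card (partition_big_imset (map_entries f)) /= -sum_nat_const.
apply: eq_bigr => _ /imsetP[u uS ->].
rewrite -(card_powprod_fibre f sHD sGD (sSP u uS)) -sum1_card.
apply: eq_bigl => v; apply/andP/setIdP=> -[vS /eqP vu]; split; try exact/eqP.
  exact: sSP.
exact: satS vS vu.
Qed.

(** Numerator and denominator are both multiples of the common cardinality of
    the fibres, which cancels. *)
Lemma rel_nil_degree_image (aT rT : finGroupType) (D : {group aT})
    (f : {morphism D >-> rT}) n (H G : {group aT}) :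
    H \subset D -> G \subset D ->
    (forall u v, u \in solutions n H G -> v \in powprod n H G ->
       map_entries f v = map_entries f u -> v \in solutions n H G) ->
  rel_nil_degree n H G
    = (#|map_entries f @: solutions n H G|%:R
       / #|map_entries f @: powprod n H G|%:R)%R.
Proof.
move=> sHD sGD satS; rewrite /rel_nil_degree -card_powprod -/(solutions n H G).
rewrite (card_saturated (f := f) sHD sGD _ satS); last first.
  by apply/subsetP=> u; rewrite inE => /andP[].
rewrite (card_saturated (f := f) sHD sGD (subxx _)) // !GRing.natrM.
rewrite -GRing.mulf_div GRing.divff ?GRing.mulr1 //.
by rewrite -GRing.natrM Num.Theory.pnatr_eq0 -lt0n muln_gt0 expn_gt0 !cardG_gt0.
Qed.

(** The invariance argument with isoclinism reduced to what it uses: a common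
    homomorphic image of the two pairs, over which solutions correspond.  Taking the
    correspondence between the two sides as the hypothesis spares a separate
    proof that the solution sets are unions of fibres. *)
Lemma rel_nil_degree_transfer (aT1 aT2 rT : finGroupType)
    (D1 : {group aT1}) (D2 : {group aT2})
    (f1 : {morphism D1 >-> rT}) (f2 : {morphism D2 >-> rT}) n
    (H1 G1 : {group aT1}) (H2 G2 : {group aT2}) :
    H1 \subset D1 -> G1 \subset D1 -> H2 \subset D2 -> G2 \subset D2 ->
    f1 @* H1 = f2 @* H2 -> f1 @* G1 = f2 @* G2 ->
    (forall u v, u \in powprod n H1 G1 -> v \in powprod n H2 G2 ->
       map_entries f1 u = map_entries f2 v ->
       (u \in solutions n H1 G1) = (v \in solutions n H2 G2)) ->
  rel_nil_degree n H1 G1 = rel_nil_degree n H2 G2.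
Proof.
move=> sH1 sG1 sH2 sG2 eqH eqG transfer.
have eqW : map_entries f1 @: powprod n H1 G1
         = map_entries f2 @: powprod n H2 G2.
  by rewrite !powprod_image_morphim // eqH eqG.
have solP (aT : finGroupType) (H G : {set aT}) (u : n.-tuple aT * aT) :
    u \in solutions n H G -> u \in powprod n H G.
  by rewrite inE => /andP[].
have partner1 u : u \in powprod n H1 G1 ->
    exists2 v, v \in powprod n H2 G2 & map_entries f1 u = map_entries f2 v.
  by move=> uP; apply/imsetP; rewrite -eqW imset_f.
have partner2 v : v \in powprod n H2 G2 ->
    exists2 u, u \in powprod n H1 G1 & map_entries f2 v = map_entries f1 u.
  by move=> vP; apply/imsetP; rewrite eqW imset_f.
have eqT : map_entries f1 @: solutions n H1 G1
         = map_entries f2 @: solutions n H2 G2.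
  apply/setP=> w; apply/imsetP/imsetP=> -[u uS ->].
    have [v vP uv] := partner1 u (solP _ _ _ _ uS).
    by exists v; rewrite -?(transfer u v (solP _ _ _ _ uS) vP uv).
  have [v vP uv] := partner2 u (solP _ _ _ _ uS).
  by exists v; rewrite ?(transfer v u vP (solP _ _ _ _ uS) (esym uv)).
(* Two tuples of one side with the same image share a partner on the other
   side, so that one is a solution as soon as the other is. *)
rewrite (rel_nil_degree_image (f := f1) sH1 sG1); last first.
  move=> u v uS vP vu; have uP := solP _ _ _ _ uS.
  have [w wP uw] := partner1 u uP.
  by rewrite (transfer v w vP wP) -?(transfer u w uP wP uw) // vu.
rewrite (rel_nil_degree_image (f := f2) sH2 sG2); last first.
  move=> u v uS vP vu; have uP := solP _ _ _ _ uS.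
  have [w wP uw] := partner2 u uP.
  by rewrite -(transfer w v wP vP) ?(transfer w u wP uP (esym uw)) // vu.
by rewrite eqT eqW.
Qed.

Theorem theoremB (n : nat) (gT1 gT2 : finGroupType)
    (G1 H1 : {group gT1}) (G2 H2 : {group gT2}) :
  0 < n -> H1 \subset G1 -> H2 \subset G2 ->
  rel_isoclinic n H1 G1 H2 G2 ->
  rel_nil_degree n H1 G1 = rel_nil_degree n H2 G2.
Proof.
move=> _ sHG1 sHG2 [alpha [beta [[isoG isoH] isoB compat]]].
have [injB _] := isomP isoB.
have nZ1 : G1 \subset 'N('Z_n(G1)) by rewrite normal_norm ?ucn_normal.
have nZ2 : G2 \subset 'N('Z_n(G2)) by rewrite normal_norm ?ucn_normal.
pose f1 := [morphism of alpha \o coset 'Z_n(G1)].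
have sGD : G1 \subset coset 'Z_n(G1) @*^-1 (G1 / 'Z_n(G1)).
  by rewrite -sub_morphim_pre.
have sHZ : H1 / 'Z_n(G1) \subset G1 / 'Z_n(G1) by apply: quotientS.
have imf1 (A : {group gT1}) (B : {group gT2}) :
    A \subset G1 -> isom (A / 'Z_n(G1)) (B / 'Z_n(G2)) alpha ->
  f1 @* A = coset 'Z_n(G2) @* B.
  move=> sAG isoA; rewrite morphim_comp.
  by rewrite (morphim_isom (quotientS _ sAG) isoA).
have commS (u : n.-tuple gT1 * gT1) : u \in powprod n H1 G1 ->
    lncomm (rcons u.1 u.2) \in lncomm_subgroup n H1 G1.
  by move=> uP; apply/mem_gen/imset_f.
apply: (rel_nil_degree_transfer (f1 := f1) (f2 := coset_morphism 'Z_n(G2)));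
  rewrite ?(subset_trans sHG1) ?(subset_trans sHG2) //; try exact: imf1.
move=> u v uP vP /map_entriesP[uv1 uv2].
rewrite ![_ \in solutions _ _ _]inE uP vP /=.
have [[uH uG] [vH vG]] := (powprodP _ _ _ uP, powprodP _ _ _ vP).
rewrite -(compat _ _ _ _ uH uG vH vG uv1 uv2).
by rewrite morph_injm_eq1 ?commS.
Qed.
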